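(* Let $K$ be a field and let $(\mathcal C,\mathbb E,\mathfrak s)$ be a $K$-linear Krull-Schmidt extriangulated category such that $\dim_K\mathrm{Hom}_{\mathcal C}(X,Y)<\infty$ and $\dim_K\mathbb E(X,Y)<\infty$ for all $X,Y\in\mathcal C$, and such that not all objects of $\mathcal C$ are projective and injective. Assume that $\mathcal C$ is locally finite. If $X\in\mathrm{Ind}(\mathcal C)$ is a non-projective object, then there is an Auslander-Reiten $\mathbb E$-triangle ending at $X$. Dually, if $X\in\mathrm{Ind}(\mathcal C)$ is a non-injective object, then there is an Auslander-Reiten $\mathbb E$-triangle starting at $X$. Hence $\mathcal C$ has Auslander-Reiten $\mathbb E$-triangles.
   Context: Extriangulated categories (Nakaoka-Palu). Let $\mathcal C$ be an additive category with a biadditive functor $\mathbb E:\mathcal C^{\mathrm{op}}\times\mathcal C\to \mathrm{Ab}$. An element $\delta\in\mathbb E(C,A)$ is an $\mathbb E$-extension; for $a:A\to A'$ and $c:C'\to C$ write $a_*\delta=\mathbb E(C,a)(\delta)$, $c^*\delta=\mathbb E(c,A)(\delta)$. A morphism from $\delta\in\mathbb E(C,A)$ to $\delta'\in\mathbb E(C',A')$ is a pair $(a,c)$, $a:A\to A'$, $c:C\to C'$, with $a_*\delta=c^*\delta'$. Sequences $A\to B\to C$ and $A\to B'\to C$ are equivalent if there is an isomorphism $B\cong B'$ compatible with the maps from $A$ and to $C$. A realization $\mathfrak s$ assigns to each $\delta\in\mathbb E(C,A)$ an equivalence class $\mathfrak s(\delta)=[A\xrightarrow{x}B\xrightarrow{y}C]$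 such that for every morphism $(a,c):\delta\to\delta'$, with $\mathfrak s(\delta')=[A'\xrightarrow{x'}B'\xrightarrow{y'}C']$, there is $b:B\to B'$ with $bx=x'a$, $y'b=cy$ (one says $(a,b,c)$ realizes $(a,c)$). It is additive if $\mathfrak s(0)=[A\to A\oplus C\to C]$ (canonical maps) and $\mathfrak s(\delta\oplus\delta')=\mathfrak s(\delta)\oplus\mathfrak s(\delta')$. The triple $(\mathcal C,\mathbb E,\mathfrak s)$ is extriangulated if: (ET1) $\mathbb E$ is a biadditive functor. (ET2) $\mathfrak s$ is an additive realization. (ET3) If $\mathfrak s(\delta)=[A\xrightarrow{x}B\xrightarrow{y}C]$, $\mathfrak s(\delta')=[A'\xrightarrow{x'}B'\xrightarrow{y'}C']$ and $bx=x'a$, there is $c:C\to C'$ such that $(a,c):\delta\to\delta'$ is a morphism realized by $(a,b,c)$. (ET3)$^{\mathrm{op}}$: if $y'b=cy$, there is $a:A\to A'$ such that $(a,c):\delta\to\delta'$ is a morphism realized by $(a,b,c)$. (ET4) If $\delta\in\mathbb E(D,A)$, $\delta'\in\mathbb E(F,B)$ are realized by $A\xrightarrow{f}B\xrightarrow{f'}D$ and $B\xrightarrow{g}C\xrightarrow{g'}F$, there are an object $E$, morphisms $h=gf:A\to C$, $h':C\to E$, $d:D\to E$, $e:E\to F$ with $h'g=df'$, $eh'=g'$, and $\delta''\in\mathbb E(E,A)$ realized by $A\xrightarrow{h}C\xrightarrow{h'}E$, such that $D\xrightarrow{d}E\xrightarrow{e}F$ realizes $f'_*\delta'$, $d^*\delta''=\delta$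 and $f_*\delta''=e^*\delta'$. (ET4)$^{\mathrm{op}}$ If $\delta\in\mathbb E(B,D)$, $\delta'\in\mathbb E(C,F)$ are realized by $D\xrightarrow{f'}A\xrightarrow{f}B$ and $F\xrightarrow{g'}B\xrightarrow{g}C$, there are an object $E$, morphisms $d:D\to E$, $e:E\to F$, $h':E\to A$, $h=gf:A\to C$ with $h'd=f'$, $fh'=g'e$, and $\delta''\in\mathbb E(C,E)$ realized by $E\xrightarrow{h'}A\xrightarrow{h}C$, such that $D\xrightarrow{d}E\xrightarrow{e}F$ realizes $g'^*\delta$, $\delta'=e_*\delta''$ and $d_*\delta=g^*\delta''$. If $A\xrightarrow{x}B\xrightarrow{y}C$ realizes $\delta\in\mathbb E(C,A)$, the data $A\xrightarrow{x}B\xrightarrow{y}C\overset{\delta}{\dashrightarrow}$ is called an $\mathbb E$-triangle; it starts at $A$ and ends at $C$, and it is split if $\delta=0$. In the $K$-linear setting the groups $\mathbb E(C,A)$ are $K$-vector spaces. An object $P$ is projective if for every $\mathbb E$-triangle $A\to B\xrightarrow{y}C\dashrightarrow$ every morphism $P\to C$ factors through $y$ (equivalently $\mathbb E(P,A)=0$ for all $A$); injective objects are defined dually. $\mathrm{Ind}(\mathcal C)$ is the set of isomorphism classes of indecomposable objects. $\mathcal C$ is locally finite if for every $A\in\mathrm{Ind}(\mathcal C)$ there are only finitely many $B\in\mathrm{Ind}(\mathcal C)$ with $\mathrm{Hom}_{\mathcal C}(A,B)\neq0$ and only finitely many $B\in\mathrm{Ind}(\mathcal C)$ with $\mathrm{Hom}_{\mathcal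 C}(B,A)\neq0$. A non-split $\delta\in\mathbb E(C,A)$ is almost split if $a_*\delta=0$ for every $a:A\to A'$ that is not a section (split monomorphism) and $c^*\delta=0$ for every $c:C'\to C$ that is not a retraction (split epimorphism). An $\mathbb E$-triangle realizing an almost split extension is an Auslander-Reiten $\mathbb E$-triangle. $\mathcal C$ has Auslander-Reiten $\mathbb E$-triangles if for every indecomposable non-projective $A$ there is an Auslander-Reiten $\mathbb E$-triangle with $\delta\in\mathbb E(A,B)$ for some $B$, and for every indecomposable non-injective $B$ there is an Auslander-Reiten $\mathbb E$-triangle with $\delta\in\mathbb E(A,B)$ for some $A$. *)

(* Defs.v *)
From mathcomp Require Import all_boot all_order all_algebra.
From mathcomp Require Import all_classical.

Set Implicit Arguments.
Unset Strict Implicit.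
Unset Printing Implicit Defensive.

Import GRing.Theory.
Local Open Scope ring_scope.
Local Open Scope classical_set_scope.

Record klinear_cat (K : fieldType) := KLinearCat {
  obj :> Type;
  Mor : obj -> obj -> lmodType K;
  idm : forall X, Mor X X;
  cmp : forall X Y Z, Mor Y Z -> Mor X Y -> Mor X Z;
  cmpA : forall W X Y Z (h : Mor Y Z) (g : Mor X Y) (f : Mor W X),
    cmp h (cmp g f) = cmp (cmp h g) f;
  cmp1m : forall X Y (f : Mor X Y), cmp (idm Y) f = f;
  cmpm1 : forall X Y (f : Mor X Y), cmp f (idm X) = f;
  cmp_linearr : forall X Y Z (g : Mor Y Z), linear (fun f : Mor X Y => cmp g f);
  cmp_linearl : forall X Y Z (f : Mor X Y), linear (fun g : Mor Y Z => cmp g f)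
}.

Arguments Mor {K k} _ _ : rename.
Arguments idm {K k} _ : rename.
Arguments cmp {K k X Y Z} _ _ : rename.

(* [g \oc f] is "g after f", written gf in the literature. *)
Notation "g \oc f" := (cmp g f) (at level 40, left associativity).

Section LinearCategories.
Variables (K : fieldType) (C : klinear_cat K).
Implicit Types (A B X Y Z S : C).

Definition is_iso X Y (f : Mor X Y) :=
  exists2 g : Mor Y X, g \oc f = idm X & f \oc g = idm Y.

Definition isomorphic X Y := exists f : Mor X Y, is_iso f.

Definition split_mono X Y (f : Mor X Y) := exists r : Mor Y X, r \oc f = idm X.

Definition split_epi X Y (f : Mor X Y) := exists s : Mor Y X, f \oc s = idm Y.

Definition zero_object Z :=
  forall X, (forall f : Mor X Z, f = 0) /\ (forall f : Mor Z X, f = 0).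

(* The structure of a direct sum of A and B carried by the object S. *)
Record biproduct A B S := Biproduct {
  in1 : Mor A S;
  in2 : Mor B S;
  pr1 : Mor S A;
  pr2 : Mor S B;
  pr1_in1 : pr1 \oc in1 = idm A;
  pr2_in2 : pr2 \oc in2 = idm B;
  pr1_in2 : pr1 \oc in2 = 0;
  pr2_in1 : pr2 \oc in1 = 0;
  biproduct_id : in1 \oc pr1 + in2 \oc pr2 = idm S
}.

Definition additive_cat :=
  (exists Z, zero_object Z) /\ (forall A B, exists S, inhabited (biproduct A B S)).

Definition hom_sum A B S (P : biproduct A B S) A' B' S' (P' : biproduct A' B' S')
    (f : Mor A A') (g : Mor B B') : Mor S S' :=
  in1 P' \oc (f \oc pr1 P) + in2 P' \oc (g \oc pr2 P).

Definition is_direct_sum n (Y : 'I_n -> C) X :=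
  exists (i : forall k, Mor (Y k) X) (p : forall k, Mor X (Y k)),
    [/\ forall k, p k \oc i k = idm (Y k),
        forall k l, k != l -> p k \oc i l = 0
      & \sum_(k < n) i k \oc p k = idm X].

(* The endomorphism ring of X is local: it is nonzero and the sum of two
   non-units is a non-unit. *)
Definition local_end X :=
  idm X <> 0 /\
  forall f g : Mor X X, ~ is_iso f -> ~ is_iso g -> ~ is_iso (f + g).

Definition krull_schmidt :=
  forall X, exists (n : nat) (Y : 'I_n -> C),
    (forall k, local_end (Y k)) /\ is_direct_sum Y X.

Definition indecomposable X :=
  ~ zero_object X /\
  forall A B, biproduct A B X -> zero_object A \/ zero_object B.

Definition iso_class X : set C := [set Y | isomorphic X Y].

Definition Ind : set (set C) := [set iso_class X | X in indecomposable].

Definition hom_nonzero X Y := exists f : Mor X Y, f <> 0.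

Definition locally_finite :=
  forall A, indecomposable A ->
    finite_set [set U | Ind U /\ exists2 B, U B & hom_nonzero A B] /\
    finite_set [set U | Ind U /\ exists2 B, U B & hom_nonzero B A].

(* A sequence A -> B -> D with fixed ends A and D. *)
Record ses A D := Ses {
  mid : C;
  infl : Mor A mid;
  defl : Mor mid D
}.

Definition ses_equiv A D (S T : ses A D) :=
  exists b : Mor (mid S) (mid T),
    [/\ is_iso b, b \oc infl S = infl T & defl T \oc b = defl S].

End LinearCategories.

Arguments zero_object {K C} Z.
Arguments indecomposable {K C} X.
Arguments local_end {K C} X.
Arguments Ses {K C A D mid} infl defl.

Definition finite_dim (K : fieldType) (V : lmodType K) :=
  exists n : nat, inhabited (Vector.axiom n V).

(* K-bilinear functors C^op x C -> K-Mod, with [push a d] = E(C,a)(d) and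
   [pull c d] = E(c,A)(d). *)
Record ext_functor (K : fieldType) (C : klinear_cat K) := ExtFunctor {
  ext_space :> C -> C -> lmodType K;
  push : forall Z A A', Mor A A' -> ext_space Z A -> ext_space Z A';
  pull : forall Z Z' A, Mor Z' Z -> ext_space Z A -> ext_space Z' A;
  push1 : forall Z A (d : ext_space Z A), push (idm A) d = d;
  pull1 : forall Z A (d : ext_space Z A), pull (idm Z) d = d;
  push_cmp : forall Z A A' A'' (a' : Mor A' A'') (a : Mor A A') (d : ext_space Z A),
    push (a' \oc a) d = push a' (push a d);
  pull_cmp : forall Z Z' Z'' A (c : Mor Z' Z) (c' : Mor Z'' Z') (d : ext_space Z A),
    pull (c \oc c') d = pull c' (pull c d);
  push_pull : forall Z Z' A A' (a : Mor A A') (c : Mor Z' Z) (d : ext_space Z A),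
    push a (pull c d) = pull c (push a d);
  push_linear : forall Z A A' (a : Mor A A'),
    linear (fun d : ext_space Z A => push a d);
  pull_linear : forall Z Z' A (c : Mor Z' Z),
    linear (fun d : ext_space Z A => pull c d);
  push_linearl : forall Z A A' (d : ext_space Z A),
    linear (fun a : Mor A A' => push a d);
  pull_linearl : forall Z Z' A (d : ext_space Z A),
    linear (fun c : Mor Z' Z => pull c d)
}.

Arguments push {K C E Z A A'} a d : rename.
Arguments pull {K C E Z Z' A} c d : rename.

(* [real d] is the equivalence class s(d), as a set of sequences. *)
Record extri_data (K : fieldType) := ExtriData {
  ecat :> klinear_cat K;
  ext : ext_functor ecat;
  real : forall (Z A : ecat), ext Z A -> set (ses A Z)
}.

Arguments ext {K} e : rename.
Arguments real {K e Z A} d : rename.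

Section Extriangulated.
Variables (K : fieldType) (C : extri_data K).
Implicit Types (A B D F Z : C).

Definition ext_mor Z A (d : ext C Z A) Z' A' (d' : ext C Z' A')
    (a : Mor A A') (c : Mor Z Z') :=
  push a d = pull c d'.

Definition ses_mor A Z (S : ses A Z) A' Z' (S' : ses A' Z')
    (a : Mor A A') (b : Mor (mid S) (mid S')) (c : Mor Z Z') :=
  b \oc infl S = infl S' \oc a /\ defl S' \oc b = c \oc defl S.

Definition realization :=
  (forall Z A (d : ext C Z A),
     exists S, forall T, real d T <-> ses_equiv S T) /\
  (forall Z A (d : ext C Z A) Z' A' (d' : ext C Z' A')
     (S : ses A Z) (S' : ses A' Z') (a : Mor A A') (c : Mor Z Z'),
     real d S -> real d' S' -> ext_mor d d' a c ->
     exists b : Mor (mid S) (mid S'), ses_mor a b c).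

(* The element of E(Z + Z', A + A') with matrix diag(d, d'). *)
Definition ext_sum Z A (d : ext C Z A) Z' A' (d' : ext C Z' A')
    SZ (PZ : biproduct Z Z' SZ) SA (PA : biproduct A A' SA) : ext C SZ SA :=
  push (in1 PA) (pull (pr1 PZ) d) + push (in2 PA) (pull (pr2 PZ) d').

Definition additive_realization :=
  (forall Z A S (P : biproduct A Z S),
     real (0 : ext C Z A) (Ses (in1 P) (pr2 P))) /\
  (forall Z A (d : ext C Z A) Z' A' (d' : ext C Z' A')
     (S : ses A Z) (S' : ses A' Z')
     SZ (PZ : biproduct Z Z' SZ) SA (PA : biproduct A A' SA)
     SM (PM : biproduct (mid S) (mid S') SM),
     real d S -> real d' S' ->
     real (ext_sum d d' PZ PA)
       (Ses (hom_sum PA PM (infl S) (infl S'))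
            (hom_sum PM PZ (defl S) (defl S')))).

Definition ET3 :=
  forall Z A (d : ext C Z A) Z' A' (d' : ext C Z' A')
    (S : ses A Z) (S' : ses A' Z') (a : Mor A A') (b : Mor (mid S) (mid S')),
    real d S -> real d' S' -> b \oc infl S = infl S' \oc a ->
    exists c : Mor Z Z', ext_mor d d' a c /\ ses_mor a b c.

Definition ET3op :=
  forall Z A (d : ext C Z A) Z' A' (d' : ext C Z' A')
    (S : ses A Z) (S' : ses A' Z') (b : Mor (mid S) (mid S')) (c : Mor Z Z'),
    real d S -> real d' S' -> defl S' \oc b = c \oc defl S ->
    exists a : Mor A A', ext_mor d d' a c /\ ses_mor a b c.

Definition ET4 :=
  forall A B M D F (d1 : ext C D A) (d2 : ext C F B)
    (f : Mor A B) (f' : Mor B D) (g : Mor B M) (g' : Mor M F),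
    real d1 (Ses f f') -> real d2 (Ses g g') ->
    exists (E : C) (h' : Mor M E) (d : Mor D E) (e : Mor E F) (d3 : ext C E A),
      (h' \oc g = d \oc f' /\ e \oc h' = g') /\
      [/\ real d3 (Ses (g \oc f) h'),
          real (push f' d2) (Ses d e),
          pull d d3 = d1
        & push f d3 = pull e d2].

Definition ET4op :=
  forall A B M D F (d1 : ext C B D) (d2 : ext C M F)
    (f' : Mor D A) (f : Mor A B) (g' : Mor F B) (g : Mor B M),
    real d1 (Ses f' f) -> real d2 (Ses g' g) ->
    exists (E : C) (d : Mor D E) (e : Mor E F) (h' : Mor E A) (d3 : ext C M E),
      (h' \oc d = f' /\ f \oc h' = g' \oc e) /\
      [/\ real d3 (Ses h' (g \oc f)),
          real (pull g' d1) (Ses d e),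
          d2 = push e d3
        & push d d1 = pull g d3].

Record extriangulated : Prop := Extriangulated {
  et_cat : additive_cat C;
  et_realization : realization;
  et_additive : additive_realization;
  et_ET3 : ET3;
  et_ET3op : ET3op;
  et_ET4 : ET4;
  et_ET4op : ET4op
}.

(* E-triangles starting at A and ending at Z. *)
Record etriangle A Z := ETriangle {
  et_ext : ext C Z A;
  et_ses :> ses A Z;
  et_real : real et_ext et_ses
}.

Definition projective_obj (P : C) :=
  forall A Z (T : etriangle A Z) (f : Mor P Z),
    exists g : Mor P (mid T), defl T \oc g = f.

Definition injective_obj (I : C) :=
  forall A Z (T : etriangle A Z) (f : Mor A I),
    exists g : Mor (mid T) I, g \oc infl T = f.

Definition almost_split Z A (d : ext C Z A) :=
  [/\ d <> 0,
      forall A' (a : Mor A A'), ~ split_mono a -> push a d = 0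
    & forall Z' (c : Mor Z' Z), ~ split_epi c -> pull c d = 0].

Definition AR_triangle A Z (T : etriangle A Z) := almost_split (et_ext T).

Definition AR_triangle_ending_at Z :=
  exists A (T : etriangle A Z), AR_triangle T.

Definition AR_triangle_starting_at A :=
  exists Z (T : etriangle A Z), AR_triangle T.

Definition has_AR_triangles :=
  (forall X : C, indecomposable X -> ~ projective_obj X -> AR_triangle_ending_at X) /\
  (forall X : C, indecomposable X -> ~ injective_obj X -> AR_triangle_starting_at X).

End Extriangulated.

Arguments projective_obj {K C} P.
Arguments injective_obj {K C} I.
Arguments AR_triangle_ending_at {K C} Z.
Arguments AR_triangle_starting_at {K C} A.

(* Main.v *)
(* Local finiteness and finite-dimensional Hom spaces give, for X with local
   endomorphism ring, a non-retraction g : M -> X through which every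
   non-retraction to X factors. If d0 is a nonzero extension in E(X, A), pushing
   it along the inflation of a realization of g^* d0 kills g^* d0 but not d0, so
   it gives a nonzero extension d with g^* d = 0, hence with c^* d = 0 for every
   non-retraction c. A nonzero component of d at an indecomposable summand is
   then almost split. The dual statement is the first one in the opposite
   category. *)
From HB Require Import structures.
Require Import Defs.
From mathcomp Require Import all_boot all_order all_algebra.
From mathcomp Require Import all_classical.

Set Implicit Arguments.
Unset Strict Implicit.
Unset Printing Implicit Defensive.

Import GRing.Theory.
Local Open Scope ring_scope.
Local Open Scope classical_set_scope.

(** * Finite sets and finite-dimensional spaces *)

Lemma finite_set_family (T : Type) (A : set T) :
  finite_set A -> exists n (F : 'I_n -> T), forall x, A x -> exists i, F i = x.
Proof.
move=> /(@finite_seqP {classic T})[s ->].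
exists (size s), (tnth (in_tuple s)) => x /= /(tnthP (in_tuple s))[i ->].
by exists i.
Qed.

(** [P] need not be closed under addition. A family in [P] whose coordinate matrix has maximal rank
    spans every vector of [P]: any vector outside its span could be added and would raise the
    rank. *)
Lemma finite_dim_subspace (K : fieldType) (V : lmodType K) (P : V -> Prop) :
  finite_dim V ->
  exists n (v : 'I_n -> V), (forall i, P (v i)) /\
    forall u, P u -> exists a : 'I_n -> K, u = \sum_i a i *: v i.
Proof.
move=> [n [[f flin [r fK rK]]]].
pose fL := GRing.isLinear.Build K V 'rV_n _ f flin.
pose g : {linear V -> 'rV_n} := HB.pack f fL.
have gK : cancel g r by [].
(* [Q k]: some finite family in [P], written as matrix rows, has rank [k]. The empty family gives
   rank 0, and [n] bounds all ranks. *)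
pose Q k := exists m (A : 'M[K]_(m, n)), (forall i, P (r (row i A))) /\ \rank A = k.
have exQ : exists k, `[< Q k >].
  exists 0%N; apply/asboolP; exists 0%N, 0; split=> [[]//|].
  by rewrite mxrank0.
have ubQ k : `[< Q k >] -> (k <= n)%N.
  by move=> /asboolP[m [A [_ <-]]]; exact: rank_leq_col.
case: (ex_maxnP exQ ubQ) => k /asboolP[m [A [PA rA]]] maxk.
exists m, (fun i => r (row i A)); split=> // u Pu.
have [/submxP[D uD]|uA] := boolP (g u <= A)%MS.
  exists (D 0); apply: (can_inj gK); rewrite linear_sum uD mulmx_sum_row.
  by apply: eq_bigr => i _; rewrite linearZ /= rK.
suff : (\rank (col_mx A (g u)) <= k)%N.
  rewrite -rA -addsmxE => le_rank; case/negP: uA.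
  have /mxrank_leqif_sup[_ le_eq] := addsmxSl A (g u).
  have : (A + g u <= A)%MS by rewrite -le_eq eqn_leq le_rank mxrankS ?addsmxSl.
  by rewrite addsmx_sub => /andP[].
apply: maxk; apply/asboolP; exists (m + 1)%N, (col_mx A (g u)); split=> // i.
rewrite -(splitK i); case: (fintype.split i) => j /=.
  by rewrite rowKu.
by rewrite rowKd ord1 row_id gK.
Qed.

(** * Composition in linear categories *)

Section LinearCategory.
Variables (K : fieldType) (C : klinear_cat K).
Implicit Types (A B X Y Z S : C).

(** Composition with one argument fixed gets a head constant, so that a linear structure can be
    attached to it. *)
Definition postcomp X Y Z (g : Mor Y Z) (f : Mor X Y) := g \oc f.
Definition precomp X Y Z (f : Mor X Y) (g : Mor Y Z) := g \oc f.

HB.instance Definition _ X Y Z (g : Mor Y Z) :=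
  GRing.isLinear.Build K (Mor X Y) (Mor X Z) _ (postcomp g) (cmp_linearr g).
HB.instance Definition _ X Y Z (f : Mor X Y) :=
  GRing.isLinear.Build K (Mor Y Z) (Mor X Z) _ (precomp f) (cmp_linearl f).

Lemma cmpDr X Y Z (g : Mor Y Z) (f f' : Mor X Y) :
  g \oc (f + f') = g \oc f + g \oc f'.
Proof. exact: (linearD (postcomp g)). Qed.

Lemma cmpDl X Y Z (g g' : Mor Y Z) (f : Mor X Y) :
  (g + g') \oc f = g \oc f + g' \oc f.
Proof. exact: (linearD (precomp f)). Qed.

Lemma cmpm0 X Y Z (g : Mor Y Z) : g \oc (0 : Mor X Y) = 0.
Proof. exact: (linear0 (postcomp g)). Qed.

Lemma cmp0m X Y Z (f : Mor X Y) : (0 : Mor Y Z) \oc f = 0.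
Proof. exact: (linear0 (precomp f)). Qed.

Lemma cmpZr X Y Z (g : Mor Y Z) a (f : Mor X Y) : g \oc (a *: f) = a *: (g \oc f).
Proof. exact: (linearZ_LR (postcomp g)). Qed.

Lemma cmp_sumr X Y Z (g : Mor Y Z) n (f : 'I_n -> Mor X Y) :
  g \oc (\sum_i f i) = \sum_i g \oc f i.
Proof. exact: (linear_sum (postcomp g)). Qed.

Lemma cmp_suml X Y Z (f : Mor X Y) n (g : 'I_n -> Mor Y Z) :
  (\sum_i g i) \oc f = \sum_i g i \oc f.
Proof. exact: (linear_sum (precomp f)). Qed.

Lemma id_is_iso X : is_iso (idm X).
Proof. by exists (idm X); rewrite cmp1m. Qed.

Lemma is_iso_cmp X Y Z (g : Mor Y Z) (f : Mor X Y) :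
  is_iso g -> is_iso f -> is_iso (g \oc f).
Proof.
move=> [g' g'g gg'] [f' f'f ff']; exists (f' \oc g').
  by rewrite cmpA -(cmpA f') g'g cmpm1.
by rewrite cmpA -(cmpA g) ff' cmpm1.
Qed.

Lemma zero_object_id X : idm X = 0 -> zero_object X.
Proof.
move=> X0 Y; split=> f; first by rewrite -[f]cmp1m X0 cmp0m.
by rewrite -[f]cmpm1 X0 cmpm0.
Qed.

Lemma split_epi_iso X (f : Mor X X) : is_iso f -> split_epi f.
Proof. by case=> s _ fs; exists s. Qed.

Lemma split_epi_cmp X Y Z (g : Mor Y Z) (f : Mor X Y) :
  split_epi (g \oc f) -> split_epi g.
Proof. by move=> [s gfs]; exists (f \oc s); rewrite cmpA. Qed.

(** * Objects with local endomorphism ring *)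

Section LocalEnd.
Variables (X : C) (locX : local_end X).

Lemma local_end_D (f g : Mor X X) : is_iso (f + g) -> is_iso f \/ is_iso g.
Proof.
move=> fg; apply: contrapT => /not_orP[nf ng]; exact: (locX.2 _ _ nf ng).
Qed.

Lemma local_end_id_sub (f : Mor X X) : ~ is_iso f -> is_iso (idm X - f).
Proof.
move=> nf; have : is_iso (idm X - f + f) by rewrite subrK; exact: id_is_iso.
by move/local_end_D => [].
Qed.

(** A section [s] of the sum writes [idm X] as a sum of two endomorphisms, [f \oc s] and [g \oc s];
    locality makes one of them invertible. *)
Lemma split_epi_D Y (f g : Mor Y X) : split_epi (f + g) -> split_epi f \/ split_epi g.
Proof.
move=> [s]; rewrite cmpDl => fgs.
have : is_iso (f \oc s + g \oc s) by rewrite fgs; exact: id_is_iso.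
by move/local_end_D => [] /split_epi_iso/split_epi_cmp; [left|right].
Qed.

Lemma split_epi0 Y : ~ split_epi (0 : Mor Y X).
Proof. by case=> s; rewrite cmp0m => /esym; exact: locX.1. Qed.

(** A decomposition gives orthogonal idempotents with sum 1. One of them is invertible, so the other
    one vanishes together with its summand. *)
Lemma local_end_indecomposable : indecomposable X.
Proof.
split=> [X0|A B P]; first by apply: locX.1; exact: (X0 X).1.
pose e1 := in1 P \oc pr1 P; pose e2 := in2 P \oc pr2 P.
have e12 : e1 \oc e2 = 0.
  by rewrite /e1 /e2 cmpA -(cmpA (in1 P)) pr1_in2 cmpm0 cmp0m.
have e21 : e2 \oc e1 = 0.
  by rewrite /e1 /e2 cmpA -(cmpA (in2 P)) pr2_in1 cmpm0 cmp0m.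
have : is_iso (e1 + e2) by rewrite biproduct_id; exact: id_is_iso.
move/local_end_D => [[h he _]|[h he _]].
  right; apply: zero_object_id.
  have e20 : e2 = 0 by rewrite -[e2]cmp1m -he -cmpA e12 cmpm0.
  have -> : idm B = pr2 P \oc e2 \oc in2 P.
    by rewrite /e2 cmpA -cmpA !pr2_in2 cmpm1.
  by rewrite e20 cmpm0 cmp0m.
left; apply: zero_object_id.
have e10 : e1 = 0 by rewrite -[e1]cmp1m -he -cmpA e21 cmpm0.
have -> : idm A = pr1 P \oc e1 \oc in1 P.
  by rewrite /e1 cmpA -cmpA !pr1_in1 cmpm1.
by rewrite e10 cmpm0 cmp0m.
Qed.

End LocalEnd.

Lemma local_end_transport X Y (f : Mor X Y) : is_iso f -> local_end X -> local_end Y.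
Proof.
move=> [g gf fg] locX.
have isof : is_iso f by exists g.
have isog : is_iso g by exists f.
have conj h : is_iso (g \oc h \oc f) -> is_iso h.
  move=> ghf; have -> : h = f \oc (g \oc h \oc f) \oc g.
    by rewrite -!cmpA fg cmpm1 cmpA fg cmp1m.
  by apply: is_iso_cmp => //; exact: is_iso_cmp.
split=> [Y0|h k nh nk hk].
  by apply: locX.1; rewrite -gf -[g]cmpm1 Y0 cmpm0 cmp0m.
have : is_iso (g \oc h \oc f + g \oc k \oc f).
  by rewrite -cmpDl -cmpDr; do 2!apply: is_iso_cmp => //.
by move/(local_end_D locX) => [] /conj.
Qed.

(** * Direct summands and indecomposables *)

(** Idempotents are not assumed to split in general. Here each summand [i k \oc p k] already splits
    through [Y k], and their sum splits through the biproduct of the [Y k], built by induction. The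
    sum need not be the identity, so the lemma yields complements of summands. *)
Lemma orthogonal_idempotents_split n (Y : 'I_n -> C) X
    (i : forall k, Mor (Y k) X) (p : forall k, Mor X (Y k)) :
  additive_cat C -> (forall k, p k \oc i k = idm (Y k)) ->
  (forall k l, k != l -> p k \oc i l = 0) ->
  exists W (u : Mor W X) (v : Mor X W),
    v \oc u = idm W /\ u \oc v = \sum_k i k \oc p k.
Proof.
move=> [[Z Z0] bip]; elim: n Y i p => [|n IH] Y i p pi1 pi0.
  exists Z, 0, 0; rewrite big_ord0 !cmp0m; split=> //.
  by apply/esym; exact: (Z0 Z).1.
have [||W [u [v [vu uv]]]] := IH _ (fun k => i (lift ord0 k)) (fun k => p (lift ord0 k)).
- by move=> k; exact: pi1.
- by move=> k l kl; apply: pi0; rewrite (inj_eq lift_inj).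
(* Writing [u] as [u \oc v \oc u] exposes the sum of the remaining idempotents, which [p ord0] kills
   by orthogonality; [vi0] is obtained in the same way. *)
have p0u : p ord0 \oc u = 0.
  rewrite -[u]cmpm1 -vu (cmpA u) uv cmp_suml cmp_sumr big1 // => k _.
  by rewrite !cmpA pi0 // !cmp0m.
have vi0 : v \oc i ord0 = 0.
  rewrite -[v]cmp1m -vu -(cmpA v) uv -cmpA cmp_suml cmp_sumr big1 // => k _.
  by rewrite -!cmpA pi0 ?cmpm0 // eq_sym.
have [S [P]] := bip (Y ord0) W.
exists S, (i ord0 \oc pr1 P + u \oc pr2 P), (in1 P \oc p ord0 + in2 P \oc v).
split.
  rewrite !(cmpDl, cmpDr) -!(cmpA (in1 P)) -!(cmpA (in2 P)) !(cmpA (p _)) !(cmpA v).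
  by rewrite pi1 vu p0u vi0 !(cmp0m, cmpm0) !cmp1m addr0 add0r biproduct_id.
rewrite !(cmpDl, cmpDr) -!(cmpA (i _)) -!(cmpA u) !(cmpA (pr1 _)) !(cmpA (pr2 _)).
rewrite pr1_in1 pr1_in2 pr2_in1 pr2_in2 !(cmp0m, cmpm0) !cmp1m addr0 add0r.
by rewrite big_ord_recl uv.
Qed.

Lemma direct_summand_biproduct n (Y : 'I_n.+1 -> C) X :
  additive_cat C -> is_direct_sum Y X -> exists W, inhabited (biproduct (Y ord0) W X).
Proof.
move=> addC [i [p [pi1 pi0 sum1]]].
have [||W [u [v [vu uv]]]] :=
  @orthogonal_idempotents_split _ _ X (fun k => i (lift ord0 k))
    (fun k => p (lift ord0 k)) addC.
- by move=> k; exact: pi1.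
- by move=> k l kl; apply: pi0; rewrite (inj_eq lift_inj).
exists W; constructor; apply: (@Biproduct _ _ _ _ _ (i ord0) u (p ord0) v) => //.
- rewrite -[u]cmpm1 -vu (cmpA u) uv cmp_suml cmp_sumr big1 // => k _.
  by rewrite !cmpA pi0 // !cmp0m.
- rewrite -[v]cmp1m -vu -(cmpA v) uv -cmpA cmp_suml cmp_sumr big1 // => k _.
  by rewrite -!cmpA pi0 ?cmpm0 // eq_sym.
- by rewrite uv -sum1 big_ord_recl.
Qed.

(** In a Krull-Schmidt decomposition the first summand is nonzero, so indecomposability forces its
    complement to vanish. Thus X is isomorphic to an object with local endomorphism ring. *)
Lemma indecomposable_local_end X :
  additive_cat C -> krull_schmidt C -> indecomposable X -> local_end X.
Proof.
move=> addC ks [nX indX]; have [[|n] [Y [locY dsY]]] := ks X.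
  have [i [p [_ _]]] := dsY; rewrite big_ord0 => /esym idX0.
  by case: nX; exact: zero_object_id.
have [W [P]] := direct_summand_biproduct addC dsY.
have [Y0|W0] := indX _ _ P; first by case: (locY ord0).1; exact: (Y0 _).1.
apply: (local_end_transport (f := in1 P)) (locY ord0).
exists (pr1 P); first exact: pr1_in1.
by rewrite -(biproduct_id P) ((W0 X).1 (pr2 P)) cmpm0 addr0.
Qed.

(** * Right almost split morphisms *)

Definition right_almost_split M X (g : Mor M X) :=
  ~ split_epi g /\
  forall Z (c : Mor Z X), ~ split_epi c -> exists h : Mor Z M, c = g \oc h.

(** The map out of the biproduct with components [c i] works: by [split_epi_D] it could be a
    retraction only if some component were one. *)
Lemma join_non_split_epi n (Y : 'I_n -> C) X (c : forall i, Mor (Y i) X) :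
  additive_cat C -> local_end X -> (forall i, ~ split_epi (c i)) ->
  exists M (g : Mor M X), ~ split_epi g /\
    forall i, exists h : Mor (Y i) M, c i = g \oc h.
Proof.
move=> addC locX; have [[Z _] bip] := addC.
elim: n Y c => [|n IH] Y c nc.
  by exists Z, 0; split=> [|[]//]; exact: split_epi0.
have [|M [g [ng gc]]] := IH _ (fun k => c (lift ord0 k)); first by move=> i; exact: nc.
have [S [P]] := bip (Y ord0) M.
exists S, (c ord0 \oc pr1 P + g \oc pr2 P); split.
  by move/(split_epi_D locX) => [] /split_epi_cmp //; exact: nc.
move=> i; case: (unliftP ord0 i) => [j|] ->.
  have [h ->] := gc j; exists (in2 P \oc h).
  by rewrite cmpDl !cmpA -!(cmpA _ _ (in2 P)) pr1_in2 pr2_in2 cmpm0 cmp0m cmpm1 add0r.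
exists (in1 P).
by rewrite cmpDl -!cmpA pr1_in1 pr2_in1 cmpm0 cmpm1 addr0.
Qed.

(** Representatives replace isomorphism classes. The family may repeat objects or contain objects
    without nonzero maps to X, so it is easy to produce. *)
Definition finitely_many_sources X := exists n (Y : 'I_n -> C),
  forall Z, indecomposable Z -> hom_nonzero Z X -> exists i, isomorphic (Y i) Z.

(** Non-retractions from one [Y i] are combinations of finitely many of them, which are joined into
    one map; a second joining runs over [i]. A general source is handled on each of its local
    summands. *)
Lemma right_almost_split_exists X :
  additive_cat C -> krull_schmidt C -> (forall Y, finite_dim (Mor Y X)) ->
  local_end X -> finitely_many_sources X -> exists M (g : Mor M X), right_almost_split g.
Proof.
move=> addC ks fdim locX [n [Y finY]].
have source i : exists M : {M : C & Mor M X}, ~ split_epi (projT2 M) /\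
    forall c : Mor (Y i) X, ~ split_epi c -> exists h, c = projT2 M \oc h.
  have [m [v [nv span]]] := finite_dim_subspace (fun c => ~ split_epi c) (fdim (Y i)).
  have [M [g [ng gv]]] := join_non_split_epi addC locX nv.
  exists (existT _ M g); split=> // c /span[a ->].
  have {gv} /fin_all_exists[h gv] := gv.
  exists (\sum_k a k *: h k); rewrite cmp_sumr; apply: eq_bigr => k _.
  by rewrite cmpZr -gv.
have {source} /fin_all_exists[M source] := source.
have [|N [g [ng gM]]] := join_non_split_epi addC locX (c := fun i => projT2 (M i)).
  by move=> i; exact: (source i).1.
exists N, g; split=> // Z c nc.
have [m [W [locW [i [p [_ _ sum1]]]]]] := ks Z.
have factor k : exists h : Mor (W k) N, c \oc i k = g \oc h.
  (* A nonzero component makes [W k] isomorphic to some [Y j]. Transported along that isomorphism it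
     is still a non-retraction, since a section of it would give one of [c]. *)
  have [->|ci0] := pselect (c \oc i k = 0); first by exists 0; rewrite cmpm0.
  have [||j [f [f' f'f ff']]] := finY (W k).
  - exact: local_end_indecomposable.
  - by exists (c \oc i k).
  have [|h ch] := (source j).2 (c \oc i k \oc f); first by do 2!move/split_epi_cmp.
  have [h' Mh'] := gM j; exists (h' \oc h \oc f').
  by rewrite !cmpA -Mh' -ch -cmpA ff' cmpm1.
have {factor} /fin_all_exists[h ch] := factor.
exists (\sum_k h k \oc p k); rewrite -[c]cmpm1 -sum1 !cmp_sumr.
by apply: eq_bigr => k _; rewrite !cmpA ch.
Qed.

End LinearCategory.

(** * Linearity of the bifunctor of extensions *)

Section ExtFunctor.
Variables (K : fieldType) (C : klinear_cat K) (E : ext_functor C).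
Implicit Types (A X Z : C).

Definition pull_along Z Z' A (d : E Z A) (c : Mor Z' Z) := pull c d.
Definition push_along Z A A' (d : E Z A) (a : Mor A A') := push a d.

HB.instance Definition _ Z A A' (a : Mor A A') :=
  GRing.isLinear.Build K (E Z A) (E Z A') _ (push a) (@push_linear _ _ E Z A A' a).
HB.instance Definition _ Z Z' A (c : Mor Z' Z) :=
  GRing.isLinear.Build K (E Z A) (E Z' A) _ (pull c) (@pull_linear _ _ E Z Z' A c).
HB.instance Definition _ Z A A' (d : E Z A) :=
  GRing.isLinear.Build K (Mor A A') (E Z A') _ (push_along d) (push_linearl d).
HB.instance Definition _ Z Z' A (d : E Z A) :=
  GRing.isLinear.Build K (Mor Z' Z) (E Z' A) _ (pull_along d) (pull_linearl d).

Lemma pullBl Z Z' A (c c' : Mor Z' Z) (d : E Z A) : pull (c - c') d = pull c d - pull c' d.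
Proof. exact: (linearB (pull_along d)). Qed.

Lemma pushBl Z A A' (a a' : Mor A A') (d : E Z A) : push (a - a') d = push a d - push a' d.
Proof. exact: (linearB (push_along d)). Qed.

Lemma push_suml Z A A' n (a : 'I_n -> Mor A A') (d : E Z A) :
  push (\sum_i a i) d = \sum_i push (a i) d.
Proof. exact: (linear_sum (push_along d)). Qed.

Lemma pull0 Z Z' A (c : Mor Z' Z) : pull c (0 : E Z A) = 0.
Proof. exact: linear0. Qed.

Lemma push0 Z A A' (a : Mor A A') : push a (0 : E Z A) = 0.
Proof. exact: linear0. Qed.

Lemma pull_iso_eq0 Z Z' A (c : Mor Z' Z) (d : E Z A) : is_iso c -> pull c d = 0 -> d = 0.
Proof. by move=> [c' _ cc'] cd; rewrite -[d]pull1 -cc' pull_cmp cd pull0. Qed.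

Lemma push_iso_eq0 Z A A' (a : Mor A A') (d : E Z A) : is_iso a -> push a d = 0 -> d = 0.
Proof. by move=> [a' a'a _] ad; rewrite -[d]push1 -a'a push_cmp ad push0. Qed.

(** If [r] were not invertible, [idm X - r] would be, by locality; but pulling back along it kills
    [d]. *)
Lemma pull_fixed_iso X A (r : Mor X X) (d : E X A) :
  local_end X -> d <> 0 -> pull r d = d -> is_iso r.
Proof.
move=> locX d0 rd; apply: contrapT => /(local_end_id_sub locX) iso; apply: d0.
by apply: (pull_iso_eq0 iso); rewrite pullBl pull1 rd subrr.
Qed.

Lemma push_fixed_iso Z A (r : Mor A A) (d : E Z A) :
  local_end A -> d <> 0 -> push r d = d -> is_iso r.
Proof.
move=> locA d0 rd; apply: contrapT => /(local_end_id_sub locA) iso; apply: d0.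
by apply: (push_iso_eq0 iso); rewrite pushBl push1 rd subrr.
Qed.

End ExtFunctor.

(* The self-dual part of the axioms that the existence proof uses. *)
Record pre_extriangulated (K : fieldType) (C : extri_data K) : Prop := PreExtriangulated {
  pe_cat : additive_cat C;
  pe_exists : forall (Z A : C) (d : ext C Z A), exists S, real d S;
  pe_mor : forall (Z A : C) (d : ext C Z A) (Z' A' : C) (d' : ext C Z' A')
    (S : ses A Z) (S' : ses A' Z') (a : Mor A A') (c : Mor Z Z'),
    real d S -> real d' S' -> ext_mor d d' a c ->
    exists b : Mor (mid S) (mid S'), ses_mor a b c;
  pe_split : forall (Z A S : C) (P : biproduct A Z S),
    real (0 : ext C Z A) (Ses (in1 P) (pr2 P));
  pe_ET3 : ET3 C;
  pe_ET3op : ET3op C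
}.

Lemma extriangulated_pre (K : fieldType) (C : extri_data K) :
  extriangulated C -> pre_extriangulated C.
Proof.
case=> addC [ex mor] [split0 _] et3 et3op _ _; split=> // Z A d.
have [S realS] := ex _ _ d; exists S; apply/realS.
by exists (idm _); split; [exact: id_is_iso|rewrite cmp1m|rewrite cmpm1].
Qed.

(** * Exactness properties and the triangle ending at X *)

Section EndingTriangle.
Variables (K : fieldType) (C : extri_data K) (hC : pre_extriangulated C).
Implicit Types (A B D M N X Z : C).

(** When the pullback vanishes, the pair of [idm A] and [c] is a morphism from the zero extension to
    [d]. It is realized by a map out of the biproduct, whose restriction to [Z'] lifts [c]. *)
Lemma pull_eq0_factor Z A (d : ext C Z A) (S : ses A Z) Z' (c : Mor Z' Z) :
  real d S -> pull c d = 0 -> exists h : Mor Z' (mid S), c = defl S \oc h.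
Proof.
move=> realS cd; have [W [P]] := (pe_cat hC).2 A Z'.
have [|b [_ /= db]] := pe_mor hC (a := idm A) (c := c) (pe_split hC P) realS.
  by rewrite /ext_mor cd push0.
by exists (b \oc in2 P); rewrite cmpA db -cmpA pr2_in2 cmpm1.
Qed.

Lemma push_eq0_factor Z A (d : ext C Z A) (S : ses A Z) A' (a : Mor A A') :
  real d S -> push a d = 0 -> exists h : Mor (mid S) A', a = h \oc infl S.
Proof.
move=> realS ad; have [W [P]] := (pe_cat hC).2 A' Z.
have [|b [/= bi _]] := pe_mor hC (a := a) (c := idm Z) realS (pe_split hC P).
  by rewrite /ext_mor ad pull0.
by exists (pr1 P \oc b); rewrite -cmpA bi cmpA pr1_in1 cmp1m.
Qed.

(** ET3, applied to [in1 P] into a split sequence starting at [mid S], presents the pushforward as a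
    pullback of 0. *)
Lemma push_infl_eq0 Z A (d : ext C Z A) (S : ses A Z) : real d S -> push (infl S) d = 0.
Proof.
move=> realS; have [W [P]] := (pe_cat hC).2 (mid S) Z.
have [c [-> _]] := pe_ET3 hC (S' := Ses (in1 P) (pr2 P)) (b := in1 P)
  realS (pe_split hC P) erefl.
exact: pull0.
Qed.

Lemma pull_defl_eq0 Z A (d : ext C Z A) (S : ses A Z) : real d S -> pull (defl S) d = 0.
Proof.
move=> realS; have [W [P]] := (pe_cat hC).2 A (mid S).
have [a [<- _]] := pe_ET3op hC (S := Ses (in1 P) (pr2 P)) (b := pr2 P)
  (pe_split hC P) realS erefl.
exact: push0.
Qed.

(** Exactness of Hom(Z', Z) -> E(Z', A) -> E(Z', B), with B the middle term of [S]. The inflation of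
    [S] extends along that of a realization of [d'], and ET3 with the identity on A supplies [c]. *)
Lemma push_infl_kernel Z A (d : ext C Z A) (S : ses A Z) Z' (d' : ext C Z' A) :
  real d S -> push (infl S) d' = 0 -> exists c : Mor Z' Z, d' = pull c d.
Proof.
move=> realS xd; have [S' realS'] := pe_exists hC d'.
have [h xh] := push_eq0_factor realS' xd.
have [|c [dc _]] := pe_ET3 hC (a := idm A) (b := h) realS' realS.
  by rewrite cmpm1 -xh.
by exists c; rewrite -dc push1.
Qed.

Lemma non_projective_ext X : ~ projective_obj X -> exists A (d : ext C X A), d <> 0.
Proof.
move=> nproj; apply: contrapT => noext; apply: nproj => A Z T f.
have [|h fh] := pull_eq0_factor (c := f) (et_real T); last by exists h.
by apply: contrapT => fd; apply: noext; exists A, (pull f (et_ext T)).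
Qed.

(* Pushing d0 along the inflation of a realization of [pull g d0] kills
   [pull g d0] but not d0: otherwise d0 = pull (g \oc c) d0 for some c, whereas
   [g \oc c] is not invertible. *)
Lemma ext_killed_by_right_almost_split M X (g : Mor M X) A (d0 : ext C X A) :
  local_end X -> ~ split_epi g -> d0 <> 0 ->
  exists N (d : ext C X N), d <> 0 /\ pull g d = 0.
Proof.
move=> locX ng d00; have [S realS] := pe_exists hC (pull g d0).
exists (mid S), (push (infl S) d0); split; last first.
  by rewrite -push_pull push_infl_eq0.
move=> /(push_infl_kernel realS)[c]; rewrite -pull_cmp => /esym gcd.
by have /split_epi_iso/split_epi_cmp := pull_fixed_iso locX d00 gcd.
Qed.

(* If [push a d] is nonzero, its realization has a non-retraction as deflation,
   which therefore factors through that of d; this yields a' with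
   [push (a' \oc a) d = d]. *)
Lemma almost_split_of_local Z A (d : ext C Z A) : local_end A -> d <> 0 ->
  (forall Z' (c : Mor Z' Z), ~ split_epi c -> pull c d = 0) -> almost_split d.
Proof.
move=> locA d0 killd; split=> // A' a na; apply: contrapT => ad0; apply: na.
have [S realS] := pe_exists hC d; have [S' realS'] := pe_exists hC (push a d).
have ndefl : ~ split_epi (defl S').
  move=> [s ys]; apply: ad0.
  by rewrite -[LHS]pull1 -ys pull_cmp pull_defl_eq0 // pull0.
have [b yb] := pull_eq0_factor realS (killd _ _ ndefl).
have [|a' [da' _]] := pe_ET3op hC (b := b) (c := idm Z) realS' realS.
  by rewrite cmp1m -yb.
have [|h ha _] := push_fixed_iso (r := a' \oc a) locA d0.
  by rewrite push_cmp da' pull1.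
by exists (h \oc a'); rewrite -cmpA.
Qed.

Lemma AR_triangle_ending X :
  krull_schmidt C -> (forall Y, finite_dim (Mor Y X)) -> finitely_many_sources X ->
  indecomposable X -> ~ projective_obj X -> AR_triangle_ending_at X.
Proof.
move=> ks fdim finX /(indecomposable_local_end (pe_cat hC) ks) locX.
move=> /non_projective_ext[A0 [d0 d00]].
have [M [g [ng gras]]] := right_almost_split_exists (pe_cat hC) ks fdim locX finX.
have [N [d [d0' gd]]] := ext_killed_by_right_almost_split locX ng d00.
have [n [Y [locY [i [p [_ _ sum1]]]]]] := ks N.
have [k pk] : exists k, push (p k) d <> 0.
  apply: contrapT => allp; apply: d0'; rewrite -[d]push1 -sum1 push_suml big1 // => k _.
  rewrite push_cmp; have -> : push (p k) d = 0 by apply: contrapT => ?; apply: allp; exists k.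
  exact: push0.
have [S realS] := pe_exists hC (push (p k) d).
(* Pushing along [p k] commutes with pulling along [g], so [g] still kills the component, and so
   does every non-retraction, being of the form [g \oc h]. *)
exists (Y k), (ETriangle realS); apply: almost_split_of_local => // Z' c /gras[h ->].
by rewrite pull_cmp -push_pull gd push0 pull0.
Qed.

End EndingTriangle.

(** * Duality through the opposite category *)

Section Opposite.
Variable K : fieldType.

(** The type of objects is kept, so an object of C is by conversion one of the opposite category. *)
Definition op_cat (C : klinear_cat K) : klinear_cat K :=
  @KLinearCat K C (fun X Y => Mor Y X) (fun X => idm X) (fun X Y Z g f => f \oc g)
    (fun W X Y Z h g f => esym (cmpA f g h))
    (fun X Y f => cmpm1 f) (fun X Y f => cmp1m f)
    (fun X Y Z g => cmp_linearl g) (fun X Y Z f => cmp_linearr f).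

Definition op_ext (C : klinear_cat K) (E : ext_functor C) : ext_functor (op_cat C) :=
  @ExtFunctor K (op_cat C) (fun Z A => E A Z)
    (fun Z A A' a d => pull (a : @Mor K C A' A) d)
    (fun Z Z' A c d => push (c : @Mor K C Z Z') d)
    (fun Z A d => pull1 d) (fun Z A d => push1 d)
    (fun Z A A' A'' a' a d => @pull_cmp K C E _ _ _ _ a a' d)
    (fun Z Z' Z'' A c c' d => @push_cmp K C E _ _ _ _ c' c d)
    (fun Z Z' A A' a c d => esym (@push_pull K C E _ _ _ _ c a d))
    (fun Z A A' a => @pull_linear K C E _ _ _ a)
    (fun Z Z' A c => @push_linear K C E _ _ _ c)
    (fun Z A A' d => @pull_linearl K C E _ _ _ d)
    (fun Z Z' A d => @push_linearl K C E _ _ _ d).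

Definition op_ses (C : klinear_cat K) (A D : C) (S : @ses K (op_cat C) A D) : @ses K C D A :=
  @Ses K C D A (mid S) (defl S) (infl S).

Definition ses_op (C : klinear_cat K) (A D : C) (S : @ses K C A D) : @ses K (op_cat C) D A :=
  @Ses K (op_cat C) D A (mid S) (defl S) (infl S).

Definition op_data (C : extri_data K) : extri_data K :=
  @ExtriData K (op_cat C) (op_ext (ext C)) (fun Z A d S => real d (op_ses S)).

Lemma biproduct_op (C : klinear_cat K) (A B S : C) :
  @biproduct K C A B S -> @biproduct K (op_cat C) A B S.
Proof.
case=> i1 i2 p1 p2 h1 h2 h12 h21 h.
exact: (@Biproduct K (op_cat C) A B S p1 p2 i1 i2).
Qed.

Lemma op_biproduct (C : klinear_cat K) (A B S : C) :
  @biproduct K (op_cat C) A B S -> @biproduct K C A B S.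
Proof.
case=> i1 i2 p1 p2 h1 h2 h12 h21 h.
exact: (@Biproduct K C A B S p1 p2 i1 i2).
Qed.

Lemma zero_object_op (C : klinear_cat K) (Z : C) :
  @zero_object K (op_cat C) Z <-> @zero_object K C Z.
Proof. by split=> Z0 X; have [] := Z0 X. Qed.

Lemma is_iso_op (C : klinear_cat K) (X Y : C) (f : @Mor K C X Y) :
  @is_iso K (op_cat C) Y X f <-> is_iso f.
Proof. by split=> [[g h1 h2]|[g h1 h2]]; exists g. Qed.

Lemma local_end_op (C : klinear_cat K) (X : C) :
  @local_end K C X -> @local_end K (op_cat C) X.
Proof.
move=> [X0 hD]; split=> // f g nf ng /is_iso_op fg.
by apply: hD fg => /is_iso_op.
Qed.

Lemma additive_cat_op (C : klinear_cat K) : additive_cat C -> additive_cat (op_cat C).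
Proof.
move=> [[Z Z0] bip]; split; first by exists Z; apply/zero_object_op.
by move=> A B; have [S [P]] := bip A B; exists S; constructor; exact: biproduct_op.
Qed.

Lemma krull_schmidt_op (C : klinear_cat K) : krull_schmidt C -> krull_schmidt (op_cat C).
Proof.
move=> ks X; have [n [Y [locY [i [p [pi1 pi0 sum1]]]]]] := ks X.
exists n, Y; split=> [k|]; first exact: local_end_op.
by exists p, i; split=> // k l kl; apply: pi0; rewrite eq_sym.
Qed.

Lemma indecomposable_op (C : klinear_cat K) (X : C) :
  @indecomposable K (op_cat C) X <-> @indecomposable K C X.
Proof.
split=> -[nX indX]; (split; first by move/zero_object_op) => A B.
  by move=> /biproduct_op/indX[] /zero_object_op; [left|right].
by move=> /op_biproduct/indX[] /zero_object_op; [left|right].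
Qed.

Lemma pre_extriangulated_op (C : extri_data K) :
  pre_extriangulated C -> pre_extriangulated (op_data C).
Proof.
case=> addC ex mor split0 et3 et3op; split.
- exact: additive_cat_op.
- by move=> Z A d; have [S realS] := ex _ _ d; exists (ses_op S); case: S realS.
- move=> Z A d Z' A' d' S S' a c rS rS' /esym dd'.
  by have [b [h1 h2]] := mor _ _ d' _ _ d (op_ses S') (op_ses S) c a rS' rS dd'; exists b.
- move=> Z A S P.
  (* Duality exchanges injections with projections, and reversing the sequence also exchanges the
     two summands. *)
  pose Q := @Biproduct K C Z A S (pr2 P) (pr1 P) (in2 P) (in1 P) (pr2_in2 P)
    (pr1_in1 P) (pr1_in2 P) (pr2_in1 P) (etrans (addrC _ _) (biproduct_id P)).
  exact: (split0 _ _ _ Q).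
- move=> Z A d Z' A' d' S S' a b rS rS' h.
  have [c [h1 [h2 h3]]] := et3op _ _ d' _ _ d (op_ses S') (op_ses S) b a rS' rS h.
  by exists c.
- move=> Z A d Z' A' d' S S' b c rS rS' h.
  have [a [h1 [h2 h3]]] := et3 _ _ d' _ _ d (op_ses S') (op_ses S) c b rS' rS h.
  by exists a.
Qed.

Lemma injective_obj_op (C : extri_data K) (X : C) :
  @projective_obj K (op_data C) X -> injective_obj X.
Proof.
move=> proj A Z T f.
have realT : @real K (op_data C) _ _ (et_ext T) (ses_op T).
  (* Once the sequence is destructed, reversing it twice computes to the same sequence. *)
  by case: T f => d [M x y].
exact: (proj _ _ (ETriangle realT) f).
Qed.

Lemma AR_triangle_ending_op (C : extri_data K) (X : C) :
  @AR_triangle_ending_at K (op_data C) X -> AR_triangle_starting_at X.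
Proof.
move=> [A [T [T0 killp killq]]].
exists A, (@ETriangle K C X A (et_ext T) (op_ses T) (et_real T)).
by split.
Qed.

End Opposite.

(** * From isomorphism classes to representatives, and the conclusion *)

Lemma finitely_many_classes (K : fieldType) (C : klinear_cat K) (P : C -> Prop) :
  additive_cat C -> finite_set [set U : set C | Ind U /\ exists2 B, U B & P B] ->
  exists n (Y : 'I_n -> C), forall Z, indecomposable Z -> P Z ->
    exists i, isomorphic (Y i) Z.
Proof.
move=> [[Z0 _] _] /finite_set_family[n [F FP]]; exists n.
have pick i : exists Y, forall Z, F i = iso_class Z -> isomorphic Y Z.
  (* An empty [F i] is not an isomorphism class, since a class contains its own object; the zero
     object is then a harmless default. *)
  have [[Y FY]|noY] := pselect (exists Y, F i Y); last first.
    exists Z0 => Z FZ; case: noY; exists Z; rewrite FZ.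
    by exists (idm Z); exact: id_is_iso.
  exists Y => Z FZ; move: FY; rewrite FZ => -[f [g gf fg]].
  by exists g; exists f.
have {pick} /fin_all_exists[Y YF] := pick; exists Y => Z indZ PZ.
have [|i Fi] := FP (iso_class Z); last by exists i; exact: YF.
split; first by exists Z.
by exists Z => //; exists (idm Z); exact: id_is_iso.
Qed.

Theorem theorem3p11 (K : fieldType) (C : extri_data K)
    (hC : extriangulated C)
    (hKS : krull_schmidt C)
    (hHom : forall X Y : C, finite_dim (Mor X Y))
    (hExt : forall X Y : C, finite_dim (ext C X Y))
    (hnontriv : ~ (forall X : C, projective_obj X /\ injective_obj X))
    (hfin : locally_finite C) :
  (forall X : C, indecomposable X -> ~ projective_obj X ->
     AR_triangle_ending_at X) /\
  (forall X : C, indecomposable X -> ~ injective_obj X ->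
     AR_triangle_starting_at X) /\
  has_AR_triangles C.
Proof.
have preC := extriangulated_pre hC.
have ending (X : C) : indecomposable X -> ~ projective_obj X -> AR_triangle_ending_at X.
  move=> indX; apply: AR_triangle_ending => //.
  exact: (finitely_many_classes (P := fun Y => hom_nonzero Y X) (pe_cat preC) (hfin X indX).2).
have starting (X : C) : indecomposable X -> ~ injective_obj X -> AR_triangle_starting_at X.
  move=> indX ninj; apply: AR_triangle_ending_op; apply: AR_triangle_ending.
  - exact: pre_extriangulated_op.
  - exact: krull_schmidt_op.
  - by move=> Y; exact: hHom.
  (* Sources of maps to X in the opposite category are targets of maps from X in C, hence the first
     half of local finiteness. *)
  - have [n [Y finY]] :=
      finitely_many_classes (P := fun Y => hom_nonzero X Y) (pe_cat preC) (hfin X indX).1.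
    exists n, Y => Z /indecomposable_op indZ homZ.
    have [i [f [g gf fg]]] := finY Z indZ homZ.
    by exists i, g; apply/is_iso_op; exists f.
  - exact/indecomposable_op.
  - by move=> /injective_obj_op.
by [].
Qed.
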